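(* Let $\lambda$ be a non-zero real number, let $r$ be a positive integer, and let $u\in\mathbb{C}$ with $u\neq 1$. For every integer $n\ge 0$, $$H_{n,\lambda}(x)=\frac{1}{(1-u)^{r}}\sum_{k=0}^{n}\binom{n}{k}2^{k}\Bigg[\sum_{j=0}^{r}\binom{r}{j}(-u)^{r-j}H_{n-k,\lambda}(j)\Bigg]h_{k,\lambda}^{(r)}(x|u),$$ where $H_{n,\lambda}(x)$ are the degenerate Hermite polynomials and $h_{k,\lambda}^{(r)}(x|u)$ are the degenerate Frobenius-Euler polynomials of order $r$ (with the convention $0^0=1$).
   Context: Fix a non-zero real number $\lambda$. The degenerate exponential functions are $e_\lambda^x(t)=(1+\lambda t)^{x/\lambda}=\sum_{n\ge 0}(x)_{n,\lambda}\frac{t^n}{n!}$, regarded as formal power series in $t$, where $(x)_{0,\lambda}=1$ and $(x)_{n,\lambda}=x(x-\lambda)\cdots(x-(n-1)\lambda)$ for $n\ge 1$; also $e_\lambda(t)=e_\lambda^1(t)$. The degenerate Hermite polynomials $H_{n,\lambda}(x)$ are defined by $$e_\lambda^{-1}(t^2)\, e_\lambda^{x}(2t)=\sum_{n=0}^\infty H_{n,\lambda}(x)\frac{t^n}{n!}.$$ For $u\in\mathbb{C}$, $u\ne 1$, the degenerate Frobenius-Euler polynomials of order $r$ are defined by $$\bigg(\frac{1-u}{e_\lambda(t)-u}\bigg)^{r}e_\lambda^x(t)=\sum_{n=0}^\infty h_{n,\lambda}^{(r)}(x|u)\frac{t^n}{n!}.$$ *)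

(* Defs.v *)
From HB Require Import structures.
From mathcomp Require Import all_boot all_order all_algebra.
From mathcomp Require Import boolp reals.
From mathcomp Require Export complex.

Set Implicit Arguments.
Unset Strict Implicit.
Unset Printing Implicit Defensive.

Import Order.TTheory GRing.Theory Num.Theory.
Local Open Scope ring_scope.

(** * Formal power series over a field

    [fps K] is K[[t]] with the Cauchy product, as a [comUnitRingType] whose
    units are the series with non-zero constant term.  Equality is pointwise
    equality of coefficients by functional extensionality. *)

Record fps (K : Type) : Type := Fps { fps_coef : nat -> K }.

Lemma fps_eqP (K : Type) (f g : fps K) : fps_coef f =1 fps_coef g -> f = g.
Proof. by case: f g => [f] [g] /= /funext ->. Qed.

HB.instance Definition _ (K : Type) := gen_eqMixin (fps K).
HB.instance Definition _ (K : Type) := gen_choiceMixin (fps K).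

Section FpsRing.
Variable K : fieldType.
Implicit Types f g h : fps K.

Definition fps_const (c : K) : fps K := Fps (fun n => if n == 0%N then c else 0).
Definition fps_var : fps K := Fps (fun n => (n == 1%N)%:R).
Definition fps_opp f : fps K := Fps (fun n => - fps_coef f n).
Definition fps_add f g : fps K := Fps (fun n => fps_coef f n + fps_coef g n).
Definition fps_mul f g : fps K :=
  Fps (fun n => \sum_(i < n.+1) fps_coef f i * fps_coef g (n - i)%N).

Fact fps_addA : associative fps_add.
Proof. by move=> f g h; apply: fps_eqP => n /=; rewrite addrA. Qed.
Fact fps_addC : commutative fps_add.
Proof. by move=> f g; apply: fps_eqP => n /=; rewrite addrC. Qed.
Fact fps_add0 : left_id (fps_const 0) fps_add.
Proof. by move=> f; apply: fps_eqP => n /=; rewrite if_same add0r. Qed.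
Fact fps_addN : left_inverse (fps_const 0) fps_opp fps_add.
Proof. by move=> f; apply: fps_eqP => n /=; rewrite if_same addNr. Qed.

HB.instance Definition _ :=
  GRing.isZmodule.Build (fps K) fps_addA fps_addC fps_add0 fps_addN.

Definition fps_trunc m f : {poly K} := \poly_(i < m.+1) fps_coef f i.

Fact coef_fps_trunc m f i : (i <= m)%N -> (fps_trunc m f)`_i = fps_coef f i.
Proof. by move=> le_im; rewrite coef_poly ltnS le_im. Qed.

Fact fps_mul_trunc m f g k : (k <= m)%N ->
  fps_coef (fps_mul f g) k = (fps_trunc m f * fps_trunc m g)`_k.
Proof.
move=> le_km; rewrite coefM /=; apply: eq_bigr => i _.
have le_ik : (i <= k)%N by rewrite -ltnS.
rewrite !coef_fps_trunc ?(leq_trans le_ik) //.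
exact: leq_trans (leq_subr _ _) le_km.
Qed.

Fact fps_mulC : commutative fps_mul.
Proof.
by move=> f g; apply: fps_eqP => n; rewrite !(@fps_mul_trunc n) // mulrC.
Qed.

Fact fps_mulA : associative fps_mul.
Proof.
move=> f g h; apply: fps_eqP => n.
have -> : fps_coef (fps_mul f (fps_mul g h)) n =
          (fps_trunc n f * (fps_trunc n g * fps_trunc n h))`_n.
  rewrite coefM [LHS]/=; apply: eq_bigr => i _.
  have le_in : (i <= n)%N by rewrite -ltnS.
  by rewrite coef_fps_trunc // -fps_mul_trunc // leq_subr.
rewrite mulrA coefM [RHS]/=; apply: eq_bigr => i _.
have le_in : (i <= n)%N by rewrite -ltnS.
by rewrite coef_fps_trunc ?leq_subr // -fps_mul_trunc.
Qed.

Fact fps_mul1 : left_id (fps_const 1) fps_mul.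
Proof.
move=> f; apply: fps_eqP => n /=; rewrite big_ord_recl /= mul1r subn0.
by rewrite big1 ?addr0 // => i _; rewrite mul0r.
Qed.

Fact fps_mulDl : left_distributive fps_mul fps_add.
Proof.
move=> f g h; apply: fps_eqP => n /=; rewrite -big_split /=.
by apply: eq_bigr => i _; rewrite mulrDl.
Qed.

Fact fps_1neq0 : fps_const 1 != 0.
Proof.
apply/eqP => /(congr1 (fun f => fps_coef f 0)) /= /eqP.
by rewrite oner_eq0.
Qed.

HB.instance Definition _ := GRing.Zmodule_isComNzRing.Build (fps K)
  fps_mulA fps_mulC fps_mul1 fps_mulDl fps_1neq0.

Lemma fps_coefD f g n : fps_coef (f + g) n = fps_coef f n + fps_coef g n.
Proof. by []. Qed.
Lemma fps_coefN f n : fps_coef (- f) n = - fps_coef f n.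
Proof. by []. Qed.
Lemma fps_coefM f g n :
  fps_coef (f * g) n = \sum_(i < n.+1) fps_coef f i * fps_coef g (n - i)%N.
Proof. by []. Qed.
Lemma fps_coef0 n : fps_coef (0 : fps K) n = 0.
Proof. exact: if_same. Qed.
Lemma fps_coef1 n : fps_coef (1 : fps K) n = (n == 0%N)%:R.
Proof. by rewrite /=; case: (n == 0%N). Qed.
Lemma fps_coef_sum (I : Type) (s : seq I) (P : pred I) (F : I -> fps K) n :
  fps_coef (\sum_(i <- s | P i) F i) n = \sum_(i <- s | P i) fps_coef (F i) n.
Proof.
exact: (big_morph (fun f => fps_coef f n) (fun f g => fps_coefD f g n)
  (fps_coef0 n)).
Qed.

Lemma fps_exp_valuation f i n :
  fps_coef f 0 = 0 -> (n < i)%N -> fps_coef (f ^+ i) n = 0.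
Proof.
move=> f0; elim: i n => // i IHi n lt_ni.
rewrite exprS fps_coefM big_ord_recl f0 mul0r add0r big1 // => j _.
by rewrite IHi ?mulr0 // lift0; move: (ltn_ord j) lt_ni; case: n j => [[]|n j] //=;
   rewrite subSS !ltnS => _; apply: leq_ltn_trans (leq_subr _ _).
Qed.

(** The composite [f (g t)] of formal power series, meaningful when [g] has
    zero constant term: the terms with [i > n] then do not contribute to the
    coefficient of [t^n] (see [fps_exp_valuation]). *)
Definition fps_comp f g : fps K :=
  Fps (fun n => \sum_(i < n.+1) fps_coef f i * fps_coef (g ^+ i) n).

Definition fps_unit : pred (fps K) := fun f => fps_coef f 0 != 0.

(** With [c = fps_coef f 0 != 0], the inverse is the geometric series
    [c^-1 * \sum_i (1 - f / c)^i]. *)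
Definition fps_inv f : fps K :=
  if fps_unit f then
    let c := fps_const (fps_coef f 0)^-1 in
    c * fps_comp (Fps (fun=> 1)) (1 - c * f)
  else f.

Fact fps_geomP f : fps_coef f 0 = 0 ->
  fps_comp (Fps (fun=> 1)) f * (1 - f) = 1.
Proof.
move=> f0; apply: fps_eqP => n.
have -> : fps_coef (fps_comp (Fps (fun=> 1)) f * (1 - f)) n =
          fps_coef ((\sum_(i < n.+1) f ^+ i) * (1 - f)) n.
  rewrite !fps_coefM; apply: eq_bigr => j _; congr (_ * _).
  rewrite fps_coef_sum /= (big_ord_widen n.+1 (fun i => 1 * fps_coef (f ^+ i) j)) //.
  rewrite [RHS](bigID (fun i : 'I_n.+1 => (i < j.+1)%N)) /=.
  rewrite [X in _ = _ + X]big1 ?addr0; last first.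
    by move=> i; rewrite -leqNgt => lt_ji; rewrite fps_exp_valuation.
  by apply: eq_bigr => i _; rewrite mul1r.
rewrite mulrC -opprB mulNr -subrX1 opprB fps_coefD fps_coefN.
by rewrite fps_exp_valuation // subr0.
Qed.

Fact fps_const_mul a b : fps_const a * fps_const b = fps_const (a * b).
Proof.
apply: fps_eqP => n; rewrite fps_coefM big_ord_recl subn0 big1 ?addr0.
  by rewrite /=; case: eqP; rewrite ?mulr0.
by move=> i _; rewrite /= mul0r.
Qed.

Fact fps_mulV : {in fps_unit, left_inverse 1 fps_inv *%R}.
Proof.
move=> f; rewrite -topredE /= => Uf; rewrite /fps_inv Uf.
set c := fps_const _.
have := @fps_geomP (1 - c * f); rewrite subKr => geom.
rewrite -mulrA mulrCA geom //.
by rewrite fps_coefD fps_coefN fps_coef1 fps_coefM big_ord1 /= mulVf ?subrr.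
Qed.

Fact fps_unitPl f g : g * f = 1 -> fps_unit f.
Proof.
move/(congr1 (fun h => fps_coef h 0)); rewrite fps_coefM big_ord1 fps_coef1 /=.
rewrite /fps_unit => gf1; apply/eqP => f0; move: gf1; rewrite f0 mulr0.
by move/eqP; rewrite eq_sym oner_eq0.
Qed.

Fact fps_inv_out : {in [predC fps_unit], fps_inv =1 id}.
Proof. by move=> f; rewrite inE /= /fps_inv => /negbTE; rewrite -topredE /= => ->. Qed.

HB.instance Definition _ := GRing.ComNzRing_hasMulInverse.Build (fps K)
  fps_mulV fps_unitPl fps_inv_out.

End FpsRing.

Arguments fps_var {K}.


Section Degenerate.
Variables (K : numFieldType) (lam : K).

(** [(x)_{n,lam} = x (x - lam) ... (x - (n-1) lam)] *)
Definition dfalling (x : K) (n : nat) : K := \prod_(i < n) (x - i%:R * lam).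

(** [e_lam^x(t)]; the superscript is a parameter, not a ring power. *)
Definition dexp (x : K) : fps K := Fps (fun n => dfalling x n / n`!%:R).

(** The [a_n] such that [f = \sum_n a_n t^n / n!]. *)
Definition egf_coef (f : fps K) (n : nat) : K := n`!%:R * fps_coef f n.

Definition dHermite (n : nat) (x : K) : K :=
  egf_coef (fps_comp (dexp (-1)) (fps_var ^+ 2)
            * fps_comp (dexp x) (2%:R * fps_var)) n.

(** For [u != 1] the denominator has constant term [1 - u != 0], so the
    division is the genuine one of K[[t]]. *)
Definition dFrobeniusEuler (r n : nat) (x u : K) : K :=
  egf_coef ((fps_const (1 - u) / (dexp 1 - fps_const u)) ^+ r * dexp x) n.

End Degenerate.

(* Main.v *)
(* The substitution t |-> 2t is multiplicative on power series, and
   e_lam^(x+y) = e_lam^x e_lam^y, so (e_lam(2t) - u)^r expands binomially into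
   the series e_lam^j(2t).  The identity is the coefficient of t^n / n! in
     (1-u)^r e_lam^-1(t^2) e_lam^x(2t)
       = [e_lam^-1(t^2) (e_lam(2t) - u)^r] [((1-u)/(e_lam(2t) - u))^r e_lam^x(2t)]. *)
Require Import Defs.
From mathcomp Require Import all_boot all_order all_algebra.
From mathcomp Require Import reals complex ring.

Import GRing.Theory Num.Theory.
Local Open Scope ring_scope.
Local Open Scope complex_scope.

Section FpsScale.
Variable K : fieldType.
Implicit Types (f g : fps K) (c : K).

(** The substitution t -> c t, set directly on coefficients so that multiplicativity is immediate;
    [fps_comp_scale] identifies it with composition. *)
Definition fps_scale c f : fps K := Fps (fun n => c ^+ n * fps_coef f n).

Lemma fps_scaleB c f g : fps_scale c (f - g) = fps_scale c f - fps_scale c g.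
Proof. by apply: fps_eqP => n /=; rewrite mulrDr mulrN. Qed.

Lemma fps_scaleM c f g : fps_scale c (f * g) = fps_scale c f * fps_scale c g.
Proof.
apply: fps_eqP => n; rewrite fps_coefM [LHS]/= mulr_sumr.
apply: eq_bigr => i _; rewrite /= mulrACA -exprD subnKC //.
by rewrite -ltnS ltn_ord.
Qed.

Lemma fps_scale_const c a : fps_scale c (fps_const a) = fps_const a.
Proof. by apply: fps_eqP => -[|n] /=; rewrite ?mul1r ?mulr0. Qed.

Lemma fps_scaleX c f r : fps_scale c (f ^+ r) = fps_scale c f ^+ r.
Proof.
elim: r => [|r IHr]; first by rewrite !expr0; exact: fps_scale_const.
by rewrite !exprS fps_scaleM IHr.
Qed.

Lemma fps_coef_constM c f n : fps_coef (fps_const c * f) n = c * fps_coef f n.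
Proof.
rewrite fps_coefM big_ord_recl subn0 big1 ?addr0 // => i _.
by rewrite /= mul0r.
Qed.

Lemma fps_const_exp c r : fps_const c ^+ r = fps_const (c ^+ r).
Proof. by elim: r => // r IHr; rewrite !exprS IHr fps_const_mul. Qed.

Lemma fps_constN c : fps_const (- c) = - fps_const c.
Proof. by apply: fps_eqP => -[|n] /=; rewrite ?oppr0. Qed.

(** Needed because the 2 in [dHermite] and the binomial coefficients of [exprDn] are numerals of the
    ring K[[t]]. *)
Lemma fps_const_nat m : fps_const (m%:R : K) = m%:R.
Proof.
elim: m => // m IHm; rewrite -[in RHS]addn1 natrD -IHm.
by apply: fps_eqP => -[|n] /=; rewrite -?natr1 ?addr0.
Qed.

Lemma fps_coef_varX i n : fps_coef (fps_var ^+ i : fps K) n = (n == i)%:R.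
Proof.
elim: i n => [|i IHi] n; first exact: fps_coef1.
rewrite exprS fps_coefM; case: n => [|n]; first by rewrite big_ord1 mul0r.
rewrite big_ord_recl mul0r add0r big_ord_recl mul1r subSS subn0 IHi.
by rewrite big1 ?addr0 // => j _; rewrite mul0r.
Qed.

Lemma fps_comp_scale c f :
  fps_comp f (fps_const c * fps_var) = fps_scale c f.
Proof.
(* As (c t)^i is a monomial of degree i, only the last index i = n contributes to t^n. *)
apply: fps_eqP => n; rewrite [LHS]/= big_ord_recr /= big1 ?add0r => [|i _].
  by rewrite exprMn fps_const_exp fps_coef_constM fps_coef_varX eqxx mulr1 mulrC.
rewrite exprMn fps_const_exp fps_coef_constM fps_coef_varX.
by rewrite gtn_eqF ?mulr0.
Qed.

End FpsScale.

Arguments fps_scale {K}.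

Section Degenerate.
Variables (K : numFieldType) (lam : K).
Implicit Types (f g : fps K) (c x y u : K).

(* The differential equation (1 + lam t) F' = x F of e_lam^x, on coefficients. *)
Lemma dexp_coefS x n :
  n.+1%:R * fps_coef (dexp lam x) n.+1 = (x - n%:R * lam) * fps_coef (dexp lam x) n.
Proof.
rewrite /= /dfalling big_ord_recr /= factS natrM.
by field; rewrite nat1r !pnatr_eq0 -lt0n fact_gt0.
Qed.

(** Both sides have constant term 1 and solve (1 + lam t) F' = (x + y) F. In characteristic zero
    this recurrence determines every coefficient. *)
Lemma dexpD x y : dexp lam (x + y) = dexp lam x * dexp lam y.
Proof.
apply: fps_eqP; elim=> [|n IHn].
  by rewrite fps_coefM big_ord1 /= /dfalling !big_ord0 fact0 divr1 mulr1.
apply: (mulfI (_ : n.+1%:R != 0)); first by rewrite pnatr_eq0.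
rewrite dexp_coefS IHn !fps_coefM mulr_sumr {IHn}.
move: (dexp_coefS x) (dexp_coefS y).
move: (fps_coef (dexp lam x)) (fps_coef (dexp lam y)) => a b aS bS.
(* Leibniz rule on coefficients: n + 1 splits as i + (n + 1 - i). *)
transitivity (\sum_(i < n.+2)
  (i%:R * a i * b (n.+1 - i)%N + a i * ((n.+1 - i)%:R * b (n.+1 - i)%N))); last first.
  rewrite mulr_sumr; apply: eq_bigr => i _.
  have le_in : (i <= n.+1)%N by rewrite -ltnS.
  have -> : n.+1%:R = i%:R + (n.+1 - i)%:R :> K by rewrite -natrD subnKC.
  ring.
(* The term i = 0 of the first sum and i = n + 1 of the second vanish; both then run over i <= n,
   and the factors x - i lam and y - (n - i) lam add up to x + y - n lam. *)
rewrite big_split [X in _ = X + _]big_ord_recl [X in _ = _ + X]big_ord_recr /=.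
rewrite subnn !mul0r mulr0 addr0 add0r -big_split /=.
apply: eq_bigr => i _; have le_in : (i <= n)%N by rewrite -ltnS.
rewrite -[bump 0 i]/i.+1 subSS subSn // aS bS.
have -> : n%:R = i%:R + (n - i)%:R :> K by rewrite -natrD subnKC.
ring.
Qed.

Lemma dexp_nat j : dexp lam j%:R = dexp lam 1 ^+ j.
Proof.
elim: j => [|j IHj]; last by rewrite -natr1 dexpD IHj exprSr.
apply: fps_eqP => n; rewrite fps_coef1 /= /dfalling.
case: n => [|n]; first by rewrite big_ord0 divr1.
(* The first factor of (0)_{n+1,lam} is 0. *)
by rewrite big_ord_recl mul0r subr0 !mul0r.
Qed.

Lemma egf_coefM f g n :
  egf_coef (f * g) n =
  \sum_(k < n.+1) 'C(n, k)%:R * egf_coef f (n - k) * egf_coef g k.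
Proof.
(* Commuting first makes k the index of [g], as in the statement. *)
rewrite mulrC /egf_coef fps_coefM mulr_sumr; apply: eq_bigr => k _.
have le_kn : (k <= n)%N by rewrite -ltnS.
rewrite -(bin_fact le_kn) !natrM; ring.
Qed.

Lemma egf_coef_constM c f n : egf_coef (fps_const c * f) n = c * egf_coef f n.
Proof. by rewrite /egf_coef fps_coef_constM mulrCA. Qed.

Lemma egf_coef_sum (I : Type) (s : seq I) (P : pred I) (F : I -> fps K) n :
  egf_coef (\sum_(i <- s | P i) F i) n = \sum_(i <- s | P i) egf_coef (F i) n.
Proof. by rewrite /egf_coef fps_coef_sum mulr_sumr. Qed.

Lemma egf_coef_scale c f n :
  egf_coef (fps_scale c f) n = c ^+ n * egf_coef f n.
Proof. by rewrite /egf_coef mulrCA. Qed.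

Lemma dHermiteE n x :
  dHermite lam n x =
  egf_coef (fps_comp (dexp lam (-1)) (fps_var ^+ 2) * fps_scale 2%:R (dexp lam x)) n.
Proof. by rewrite /dHermite -fps_const_nat fps_comp_scale. Qed.

Lemma sum_dHermite u r n :
  \sum_(j < r.+1) 'C(r, j)%:R * (- u) ^+ (r - j) * dHermite lam n j%:R =
  egf_coef (fps_comp (dexp lam (-1)) (fps_var ^+ 2)
            * fps_scale 2%:R (dexp lam 1 - fps_const u) ^+ r) n.
Proof.
(* [exprDn] gives the exponent r - j to the first summand, so -u is moved to the front. *)
rewrite fps_scaleB fps_scale_const addrC exprDn mulr_sumr egf_coef_sum.
apply: eq_bigr => j _; rewrite dHermiteE -egf_coef_constM dexp_nat fps_scaleX.
rewrite -fps_const_mul fps_const_nat -fps_const_exp fps_constN -mulr_natl.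
by congr egf_coef; ring.
Qed.

Lemma dFrobeniusEuler_series u r x : u != 1 ->
  (dexp lam 1 - fps_const u) ^+ r
    * ((fps_const (1 - u) / (dexp lam 1 - fps_const u)) ^+ r * dexp lam x) =
  fps_const ((1 - u) ^+ r) * dexp lam x.
Proof.
move=> u_neq1; have unit_den : dexp lam 1 - fps_const u \is a GRing.unit.
  (* Units of K[[t]] are by definition the series with non-zero constant term, here 1 - u. *)
  suff: fps_coef (dexp lam 1 - fps_const u) 0 != 0 by [].
  by rewrite /= /dfalling big_ord0 divr1 subr_eq0 eq_sym.
by rewrite mulrA -exprMn [X in X ^+ r]mulrC divrK // fps_const_exp.
Qed.

Lemma dHermite_dFrobeniusEuler r u n x : u != 1 ->
  dHermite lam n x =
  1 / (1 - u) ^+ r *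
  \sum_(k < n.+1)
    'C(n, k)%:R * 2%:R ^+ k *
    (\sum_(j < r.+1)
       'C(r, j)%:R * (- u) ^+ (r - j) * dHermite lam (n - k) j%:R) *
    dFrobeniusEuler lam r k x u.
Proof.
move=> u_neq1; have u1r : (1 - u) ^+ r != 0 by rewrite expf_neq0 // subr_eq0 eq_sym.
apply: (mulfI u1r); rewrite div1r mulVKf //.
rewrite dHermiteE -egf_coef_constM mulrCA.
(* The constant (1 - u)^r is fixed by t -> 2t, so it can enter the rescaled series, where
   [dFrobeniusEuler_series] factors it. *)
rewrite -(fps_scale_const K 2%:R ((1 - u) ^+ r)) -fps_scaleM.
rewrite -(dFrobeniusEuler_series _ _ _ u_neq1) fps_scaleM fps_scaleX mulrA egf_coefM.
apply: eq_bigr => k _; rewrite sum_dHermite egf_coef_scale.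
by rewrite mulrA; congr (_ * _); rewrite mulrAC.
Qed.

End Degenerate.

Theorem theorem9 (R : realType) (lam : R) (r : nat) (u : R[i])
    (lam_neq0 : lam != 0) (r_gt0 : (0 < r)%N) (u_neq1 : u != 1) :
  forall (n : nat) (x : R[i]),
    dHermite lam%:C n x =
    1 / (1 - u) ^+ r *
    \sum_(k < n.+1)
      'C(n, k)%:R * 2%:R ^+ k *
      (\sum_(j < r.+1)
         'C(r, j)%:R * (- u) ^+ (r - j) * dHermite lam%:C (n - k) j%:R) *
      dFrobeniusEuler lam%:C r k x u.
Proof. by move=> n x; exact: (dHermite_dFrobeniusEuler _ lam%:C r u n x u_neq1). Qed.
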